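(* Let $G$ be a graph with $n$ vertices. Then for every $k \in \mathbb{N}$, $$\frac{P_{\ell}(G,k+1)}{(k+1)^n} \geq \frac{P_{\ell}(G,k)}{k^n}.$$
   Context: All graphs are finite, simple, and nonempty (at least one vertex). $\mathbb{N}$ denotes the set of positive integers. A list assignment $L$ of a graph $G$ assigns to each $v \in V(G)$ a set $L(v)$ of colors; it is a $k$-assignment if $|L(v)| = k$ for every $v \in V(G)$. A proper $L$-coloring of $G$ is a function $f$ on $V(G)$ with $f(v) \in L(v)$ for every $v \in V(G)$ and $f(u) \neq f(v)$ whenever $uv \in E(G)$. $P(G,L)$ denotes the number of proper $L$-colorings of $G$. The list color function $P_{\ell}(G,k)$ is the minimum of $P(G,L)$ over all $k$-assignments $L$ of $G$. *)

(* Defs.v *)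
From mathcomp Require Import all_boot all_order all_algebra finmap.
From mathcomp Require Import boolp.
Set Implicit Arguments.
Unset Strict Implicit.
Unset Printing Implicit Defensive.

Local Open Scope fset_scope.

Record sgraph := SGraph {
  vertex :> finType;
  adj : rel vertex;
  adj_sym : symmetric adj;
  adj_irr : irreflexive adj;
  vertex_gt0 : 0 < #|vertex| }.

Definition list_assignment (G : sgraph) (C : choiceType) := G -> {fset C}.

Definition is_assignment (G : sgraph) (C : choiceType) (k : nat)
    (L : list_assignment G C) : Prop :=
  forall v, #|` L v| = k.

(* The condition f(v) \in L(v) is carried by the dependent type of f, where
   each L v is seen as a finite type; fsval forgets it, so that colors from
   different lists can be compared. *)
Definition is_proper (G : sgraph) (C : choiceType) (L : list_assignment G C)
    (f : {dffun forall v : G, L v}) : bool :=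
  [forall u, forall v, adj u v ==> (fsval (f u) != fsval (f v))].

Definition num_colorings (G : sgraph) (C : choiceType)
    (L : list_assignment G C) : nat :=
  #|[set f : {dffun forall v : G, L v} | is_proper f]|.

(* Lists may be taken from any type of colors. *)
Definition attained (G : sgraph) (k m : nat) : Prop :=
  exists (C : choiceType) (L : list_assignment G C),
    is_assignment k L /\ num_colorings L = m.

Lemma attained_ex (G : sgraph) (k : nat) : exists m, `[< attained G k m >].
Proof.
pose L : list_assignment G nat := fun=> [fset x in iota 0 k].
exists (num_colorings L); apply/asboolP; exists nat, L; split=> // v.
by rewrite card_fseq undup_id ?iota_uniq // size_iota.
Qed.

Definition list_color_function (G : sgraph) (k : nat) : nat :=
  ex_minn (attained_ex G k).

Lemma list_color_functionP (G : sgraph) (k : nat) :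
  attained G k (list_color_function G k) /\
  forall (C : choiceType) (L : list_assignment G C),
    is_assignment k L -> list_color_function G k <= num_colorings L.
Proof.
rewrite /list_color_function; case: ex_minnP => m /asboolP mP min_m.
by split=> // C L kL; apply: min_m; apply/asboolP; exists C, L.
Qed.

(* Main.v *)
Require Import Defs.
From mathcomp Require Import all_boot all_order all_algebra.
From mathcomp Require Import finmap.
Import Order.TTheory GRing.Theory Num.Theory.
Local Open Scope ring_scope.

(** The proof is an averaging argument.  Take a [k.+1]-assignment [L] with the
    fewest proper colorings, and delete from every list one color, chosen
    uniformly and independently.  What remains is a [k]-assignment, so it always
    has at least [list_color_function G k] proper colorings.  On the other hand
    a proper [L]-coloring [f] survives exactly when the color deleted at each
    vertex [v] differs from [f v], which has probability [(k / k.+1) ^ n]; so the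
    expected number of surviving colorings is [(k / k.+1) ^ n] times the number
    of proper [L]-colorings.  The expectation is at least the minimum, which is
    the claim.

    Probabilities are replaced by counting: a choice of deleted colors is itself
    a choice function [d : {dffun forall v, L v}], proper or not, and the pairs
    [(d, f)] with [f] proper and [f v != d v] for all [v] are counted in two
    ways ([sum_num_avoiding]). *)

Section Averaging.

Variables (G : sgraph) (C : choiceType) (L : list_assignment G C).
Implicit Types d f : {dffun forall v : G, L v}.

Definition delete_colors d : list_assignment G C :=
  fun v => (L v `\ fsval (d v))%fset.

Definition avoids d f : bool := [forall v, f v != d v].

Lemma delete_colors_assignment k d :
  is_assignment k.+1 L -> is_assignment k (delete_colors d).
Proof.
move=> cardL v; apply/succn_inj; rewrite -(cardL v) (cardfsD1 (fsval (d v)) (L v)).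
by rewrite (fsvalP (d v)).
Qed.

(** The type of a coloring mentions its lists, so a coloring for the reduced
    lists is not literally one for [L]; it is transported by inclusion of lists,
    an injective map that keeps the colors themselves unchanged. *)
Lemma num_colorings_delete d :
  (num_colorings (delete_colors d) <= #|[set f | is_proper f && avoids d f]|)%N.
Proof.
have sub v : (delete_colors d v `<=` L v)%fset by apply: fsubsetDl.
pose widen (g : {dffun forall v, delete_colors d v}) : {dffun forall v, L v} :=
  [ffun v => fincl (sub v) (g v)].
have widenE g v : fsval (widen g v) = fsval (g v) by rewrite ffunE.
have widen_inj : injective widen.
  move=> g1 g2 eq_g; apply/ffunP => v; apply: val_inj.
  by rewrite /= -!widenE eq_g.
rewrite /num_colorings -(card_imset _ widen_inj); apply: subset_leq_card.
apply/subsetP => _ /imsetP[g g_proper ->]; rewrite inE in g_proper.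
rewrite inE; apply/andP; split.
  apply/forallP => u; apply/forallP => v; rewrite !widenE.
  by move/forallP/(_ u)/forallP: g_proper; apply.
apply/forallP => v; rewrite -val_eqE /= widenE.
by have := fsvalP (g v); rewrite in_fsetD1 => /andP[].
Qed.

Lemma card_choices k :
  is_assignment k L -> #|{dffun forall v : G, L v}| = (k ^ #|G|)%N.
Proof.
move=> cardL; rewrite card_dep_ffun foldrE big_image /=.
by under eq_bigr do rewrite -cardfE cardL; rewrite prod_nat_const.
Qed.

Lemma card_avoiding k f :
  is_assignment k.+1 L -> #|[set d | avoids d f]| = (k ^ #|G|)%N.
Proof.
move=> cardL.
have -> : [set d | avoids d f] = setXn (fun v => [set~ f v]).
  apply/setP => d; rewrite inE; apply/forallP/setXnP => avoid v;
    by move: (avoid v); rewrite !inE eq_sym.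
rewrite cardsXn; under eq_bigr do rewrite cardsC1 -cardfE cardL.
by rewrite prod_nat_const.
Qed.

Lemma sum_num_avoiding k : is_assignment k.+1 L ->
  (\sum_d #|[set f | is_proper f && avoids d f]| =
    num_colorings L * k ^ #|G|)%N.
Proof.
move=> cardL.
under eq_bigr => d _.
  rewrite -sum1dep_card big_mkcondr /=; over.
rewrite exchange_big /= /num_colorings -sum1dep_card big_distrl /=.
apply: eq_bigr => f _; rewrite mul1n -(card_avoiding _ f cardL).
by rewrite -sum1dep_card -big_mkcond.
Qed.

Lemma list_color_function_avg k : is_assignment k.+1 L ->
  (list_color_function G k * k.+1 ^ #|G| <= num_colorings L * k ^ #|G|)%N.
Proof.
move=> cardL; rewrite -(sum_num_avoiding _ cardL) -(card_choices _ cardL).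
rewrite mulnC -sum_nat_const; apply: leq_sum => d _.
apply: leq_trans (num_colorings_delete d).
have [_ min_k] := list_color_functionP G k.
exact/min_k/delete_colors_assignment.
Qed.

End Averaging.

Theorem theorem3 (G : sgraph) (n : nat) (hn : #|G| = n) (k : nat)
    (hk : (0 < k)%N) :
  (list_color_function G k.+1)%:R / k.+1%:R ^+ n
    >= (list_color_function G k)%:R / k%:R ^+ n :> rat.
Proof.
have [[C [L [cardL <-]]] _] := list_color_functionP G k.+1.
rewrite ler_pdivrMr ?exprn_gt0 ?ltr0n // mulrAC.
rewrite ler_pdivlMr ?exprn_gt0 ?ltr0n // -!natrX -!natrM ler_nat -hn.
exact: list_color_function_avg.
Qed.
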